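(* For every positive integer $n$, the number of maximal configurations of length $n$ in the Riviera model is equal to the number of permutations $\pi$ of $\{1,\dots,n+4\}$ satisfying $\pi(i)-i\in\{-2,-1,2\}$ for all $i\in\{1,\dots,n+4\}$.
   Context: Riviera model: a configuration of length $n$ is a word $C=(c_1,\dots,c_n)\in\{0,1\}^n$ ($c_i=1$: lot $i$ occupied; $c_i=0$: empty), with $c_j=0$ for $j\le 0$ and $j\ge n+1$. $C$ is permissible if there is no $i\in\{1,\dots,n\}$ with $c_{i-1}=c_i=c_{i+1}=1$. $C$ is maximal if it is permissible and for every $i$ with $c_i=0$, changing $c_i$ to $1$ yields a non-permissible configuration. *)

(* Defs.v *)
From mathcomp Require Import all_boot.

Set Implicit Arguments.
Unset Strict Implicit.
Unset Printing Implicit Defensive.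

Definition configuration (n : nat) := n.-tuple bool.

(* c_j with lots numbered from 1 as in c_1, ..., c_n, and c_j = 0 for j = 0 and
   for j > n; [tnth C i] is therefore c_(i+1). *)
Definition lot (n : nat) (C : configuration n) (j : nat) : bool :=
  if j is k.+1 then nth false C k else false.

Definition occupy (n : nat) (C : configuration n) (i : 'I_n) : configuration n :=
  [tuple (j == i) || tnth C j | j < n].

(* The ordinal i stands for lot i.+1, whose neighbours are lots i and i.+2. *)
Definition permissible (n : nat) (C : configuration n) : bool :=
  [forall i : 'I_n, ~~ [&& lot C i, lot C i.+1 & lot C i.+2]].

Definition maximal_configuration (n : nat) (C : configuration n) : bool :=
  permissible C &&
  [forall i : 'I_n, ~~ tnth C i ==> ~~ permissible (occupy C i)].

(* Main.v *)
(** Build a permutation [s] with displacements -2, -1, 2 by choosing s(1), s(2), ...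
    in turn.  Before s(i) is chosen, all values up to i - 3 are taken, and so are
    exactly two of the four values i - 2, ..., i + 1, which leaves six possible
    states.  A maximal configuration, read from left to right, is accepted by an
    automaton with the same six states and the same transitions: blocks of one or
    two occupied lots are separated by one empty lot, or by two when both
    neighbouring blocks have length two.  The two languages differ only at the
    ends: the first choice of [s] is forced, and a word is accepted exactly when
    the corresponding permutation can be completed in three more steps, which it
    then is in a unique way. *)

Require Import Defs.
From mathcomp Require Import all_boot perm ssralg ssrint.
From mathcomp Require Import zify.

(** * Counting words by their first letter *)

Lemma card_tupleS (T : finType) (P : pred (seq T)) (m : nat) :
  #|[set t : m.+1.-tuple T | P t]| =
  \sum_(x : T) #|[set t : m.-tuple T | P (x :: t)]|.
Proof.
rewrite -sum1dep_card.
rewrite (reindex (fun p : T * m.-tuple T => [tuple of p.1 :: p.2])) /=; last first.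
  exists (fun t : m.+1.-tuple T => (thead t, [tuple of behead t])) => [[x t]|t] _ /=.
    by congr pair; apply: val_inj.
  by rewrite [RHS]tuple_eta; apply: val_inj.
rewrite -(pair_big_dep xpredT (fun x (t : m.-tuple T) => P (x :: t))
  (fun _ _ => 1)) /=.
by apply: eq_bigr => x _; rewrite sum1dep_card.
Qed.

Lemma card_tuple0 (T : finType) (P : pred (seq T)) :
  #|[set t : 0.-tuple T | P t]| = P [::].
Proof.
rewrite -sum1dep_card; case Pn: (P [::]).
  rewrite (big_pred1 [tuple]) // => t.
  by rewrite [t]tuple0 /= Pn; apply/esym/eqP/val_inj.
by rewrite big_pred0 // => t; rewrite [t]tuple0 /= Pn.
Qed.

(** * Maximality as a local condition on five consecutive lots *)

(* Validity of lot [c] between [a b] and [d e]: no three occupied lots end at [c],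
   and if [c] is empty, occupying it completes such a triple. *)
Definition window (a b c d e : bool) : bool :=
  ~~ [&& a, b & c] && [|| c, a && b, b && d | d && e].

(** [a] and [b] are the two lots read last; the default [false] stands for the empty lots past the
    end. *)
Fixpoint scan (a b : bool) (s : seq bool) : bool :=
  if s is c :: s' then
    window a b c (nth false s' 0) (nth false s' 1) && scan b c s'
  else true.

Lemma scanP (a b : bool) (s : seq bool) :
  reflect (forall i, i < size s ->
             let c := nth false [:: a, b & s] in
             window (c i) (c i.+1) (c i.+2) (c i.+3) (c i.+4))
          (scan a b s).
Proof.
elim: s a b => [|c s IHs] a b /=; first by apply: ReflectT.
apply: (iffP andP) => [[win0 /IHs winS] [|i] // /winS // | win].
by split; [apply: (win 0) | apply/IHs => i /(win i.+1)].
Qed.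

Lemma lot_gt (n : nat) (C : configuration n) (j : nat) : n < j -> lot C j = false.
Proof. by case: j => //= j le_nj; rewrite nth_default ?size_tuple. Qed.

Lemma lot_occupy (n : nat) (C : configuration n) (i : 'I_n) (j : nat) :
  lot (occupy C i) j = (j == i.+1) || lot C j.
Proof.
case: j => // j; rewrite eqSS /lot.
have [lt_jn|le_nj] := ltnP j n; last first.
  rewrite !nth_default ?size_tuple // gtn_eqF //.
  exact: leq_trans (ltn_ord i) le_nj.
have E (D : configuration n) : nth false D j = tnth D (Ordinal lt_jn).
  by rewrite (tnth_nth false).
by rewrite !E tnth_mktuple.
Qed.

Lemma permissibleP (n : nat) (C : configuration n) :
  reflect (forall j, ~~ [&& lot C j, lot C j.+1 & lot C j.+2]) (permissible C).
Proof.
apply: (iffP forallP) => [perm_C j | //].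
have [lt_jn|le_nj] := ltnP j n; first exact: (perm_C (Ordinal lt_jn)).
by rewrite (@lot_gt _ C j.+1) // andbF.
Qed.

(** Only the three triples through lot [i.+1] can change. For [i = 0] the first disjunct is false
    because [lot C 0] is. *)
Lemma permissible_occupy (n : nat) (C : configuration n) (i : 'I_n) :
  permissible C ->
  permissible (occupy C i) =
  ~~ [|| lot C i.-1 && lot C i, lot C i && lot C i.+2 | lot C i.+2 && lot C i.+3].
Proof.
move=> /permissibleP perm_C; apply/permissibleP/idP => [perm_Ci | not_filled j].
  rewrite !negb_or; apply/and3P; split.
  - case Ei: (nat_of_ord i) => [|k] //=.
    by have := perm_Ci k; rewrite !lot_occupy Ei eqxx /= andbT !ltn_eqF.
  - by have := perm_Ci i; rewrite !lot_occupy eqxx /= ltn_eqF // gtn_eqF.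
  by have := perm_Ci i.+1; rewrite !lot_occupy eqxx /= !gtn_eqF.
rewrite !lot_occupy !eqSS.
have [->|ne_j] := eqVneq j i.+1.
  by rewrite !gtn_eqF //=; apply: contraNN not_filled => ->; rewrite !orbT.
have [->|ne_ji] := eqVneq j i.
  by rewrite gtn_eqF //=; apply: contraNN not_filled => ->; rewrite !orbT.
have [Ei|ne_i] /= := eqVneq j.+1 i; last exact: perm_C.
by rewrite andbT; apply: contraNN not_filled; rewrite -Ei => ->.
Qed.

Lemma maximal_configurationE (n : nat) (C : configuration n) :
  maximal_configuration C = scan false false C.
Proof.
(* Both padding letters become lot 0 through the truncated predecessor. *)
have lotE j : nth false [:: false, false & C] j = lot C j.-1 by case: j => [|[]].
have maxE : permissible C -> forall i : 'I_n,
    (~~ tnth C i ==> ~~ permissible (occupy C i)) =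
    [|| lot C i.+1, lot C i.-1 && lot C i, lot C i && lot C i.+2
      | lot C i.+2 && lot C i.+3].
  by move=> perm_C i; rewrite permissible_occupy // negbK (tnth_nth false) implyNb.
apply/andP/scanP => [[perm_C /forallP max_C] i | win]; last first.
  have {}win i : i < n ->
      window (lot C i.-1) (lot C i) (lot C i.+1) (lot C i.+2) (lot C i.+3).
    by move=> lt_in; have := win i; rewrite size_tuple; cbv zeta; rewrite !lotE; apply.
  have perm_C : permissible C.
    apply/permissibleP => j; have [lt_jn|le_nj] := ltnP j.+1 n.
      by have /andP[] := win _ lt_jn.
    by rewrite (@lot_gt _ C j.+2) ?andbF.
  split=> //; apply/forallP => i; rewrite maxE //.
  by have /andP[] := win i (ltn_ord i).
rewrite size_tuple => lt_in; cbv zeta; rewrite !lotE /=.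
have := max_C (Ordinal lt_in); rewrite maxE //= => max_i.
apply/andP; split=> //.
by case: i {lt_in max_i} => [|i] //; apply: (permissibleP _ _ perm_C).
Qed.

(** * The six-state automaton *)

(* Before the value at position i is chosen, bit j of the name tells whether the
   value i - 2 + j is already taken. *)
Inductive state := S1100 | S1001 | S1010 | S0011 | S0101 | S0110.

(* The words [s] that may follow, in a maximal configuration, a prefix ending in
   [11], [110], [01], [1100], [010], [001] respectively. *)
Definition continuation (q : state) (s : seq bool) : bool :=
  match q with
  | S1100 => scan true true s
  | S1001 => scan false false s
  | S1010 => scan false true s
  | S0011 => [&& nth false s 0, nth false s 1 & scan false false s]
  | S0101 => nth false s 0 && scan true false s
  | S0110 => nth false s 0 && scan false true s
  end.

Definition free (q : state) : seq nat :=
  match q with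
  | S1100 => [:: 2; 3]
  | S1001 => [:: 1; 2]
  | S1010 => [:: 1; 3]
  | S0011 => [:: 0; 1]
  | S0101 => [:: 0; 2]
  | S0110 => [:: 0; 3]
  end.

(** The letter [false] stands for displacement 2, and [true] for -2 or -1. No state allows both of
    the latter: a free value i - 2 must be taken at once. *)
Definition step (q : state) (b : bool) : option state :=
  match q, b with
  | S1100, false => Some S1001
  | S1001, false => Some S0011
  | S1001, true => Some S1010
  | S1010, false => Some S0101
  | S1010, true => Some S1100
  | S0011, true => Some S0110
  | S0101, true => Some S1010
  | S0110, true => Some S1100
  | _, _ => None
  end.

(** A window looks two lots ahead, so two letters after [b] decide. Moreover [scan a false] does not
    depend on [a]. *)
Lemma continuation_cons (q : state) (b : bool) (s : seq bool) :
  continuation q (b :: s) = if step q b is Some q' then continuation q' s else false.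
Proof.
case: q b => [] [] //=; rewrite /window /= ?andbT ?andbF //.
all: case: s => [|c [|d s]] //=.
all: by rewrite /window; case: c => //=; try case: d.
Qed.

(** * Counting permutations by choosing their values in turn *)

(* Displacements are increased by 2, so that the values relative to the current
   position are natural numbers. *)
Definition shift (k : 'I_3) : nat := nth 0 [:: 0; 1; 4] k.

Fixpoint values (w : seq 'I_3) : seq nat :=
  if w is k :: w' then shift k :: map S (values w') else [::].

Lemma perm_map_succ (s t : seq nat) :
  perm_eq (map S s) t = (0 \notin t) && perm_eq s (map predn t).
Proof.
apply/idP/andP => [st | [t0 st]].
  split; first by rewrite -(perm_mem st); apply/mapP => -[].
  by have := perm_map predn st; rewrite -map_comp map_id.
have -> : t = map S (map predn t); last exact: perm_map.
rewrite -map_comp -[LHS]map_id; apply/eq_in_map => x xt /=.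
by rewrite prednK // lt0n; apply: contraNneq t0 => <-.
Qed.

Lemma perm_cons_rem (T : eqType) (x : T) (s t : seq T) :
  perm_eq (x :: s) t = (x \in t) && perm_eq s (rem x t).
Proof.
case xt: (x \in t) => /=; first by rewrite (permPr (perm_to_rem xt)) perm_cons.
by apply: contraFF xt => /perm_mem <-; rewrite mem_head.
Qed.

Definition arrangements (m : nat) (U : seq nat) : nat :=
  #|[set w : m.-tuple 'I_3 | perm_eq (values w) U]|.

(** Relative value 0 must not be left over, since later positions cannot reach it. *)
Definition arrangements_from (m : nat) (U : seq nat) (x : nat) : nat :=
  if (x \in U) && (0 \notin rem x U)
  then arrangements m (map predn (rem x U)) else 0.

Lemma arrangementsS (m : nat) (U : seq nat) :
  arrangements m.+1 U = arrangements_from m U 0 + arrangements_from m U 1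
                        + arrangements_from m U 4.
Proof.
rewrite /arrangements (@card_tupleS _ (fun w => perm_eq (values w) U)).
rewrite (eq_bigr (fun k => arrangements_from m U (shift k))) => [|k _].
  by rewrite !big_ord_recl big_ord0 addn0 addnA.
rewrite /arrangements_from /arrangements.
under eq_finset => w do rewrite /= perm_cons_rem perm_map_succ andbA.
case: ifP => // _; apply/eqP; rewrite cards_eq0; apply/eqP/setP => w.
by rewrite !inE.
Qed.

Lemma arrangements0 (U : seq nat) : arrangements 0 U = (U == [::]).
Proof.
rewrite /arrangements (@card_tuple0 _ (fun w => perm_eq (values w) U)).
by rewrite /= perm_sym; congr nat_of_bool; apply/perm_nilP/eqP.
Qed.

(** Induction along [step]. With three positions left, [free q ++ [:: 4]] has one completion if [q]
    accepts the empty word, and none otherwise. *)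
Lemma arrangements_free (q : state) (m : nat) :
  arrangements m.+3 (free q ++ iota 4 m.+1) =
  #|[set s : m.-tuple bool | continuation q s]|.
Proof.
elim: m q => [|m IHm] q.
  rewrite card_tuple0.
  by case: q; do 3! rewrite ?arrangementsS /arrangements_from /=;
    rewrite ?arrangements0.
rewrite card_tupleS big_bool.
have E b : #|[set s : m.-tuple bool | continuation q (b :: s)]| =
    if step q b is Some q' then arrangements m.+3 (free q' ++ iota 4 m.+1) else 0.
  under eq_finset => s do rewrite continuation_cons.
  case: (step q b) => [q'|]; first by rewrite IHm.
  by apply/eqP; rewrite cards_eq0; apply/eqP/setP => s; rewrite !inE.
have iota_pred k : map predn (iota 5 k) = iota 4 k.
  by rewrite (iotaDl 1 4) -map_comp map_id.
rewrite !E arrangementsS /arrangements_from -[iota 4 m.+2]/(4 :: iota 5 m.+1).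
(* Abstracting the two tails keeps them folded: only their shift and membership matter. *)
move: (iota_pred m.+1) (mem_iota 5 m.+1).
move: (iota 4 m.+1) (iota 5 m.+1) => V W pred_W mem_W.
by case: q {E}; rewrite /= !inE !mem_W /= ?pred_W ?addn0 ?add0n // addnC.
Qed.

(** * Permutations as words of displacements *)

Definition displacement_code (N : nat) (s : 'S_N) : N.-tuple 'I_3 :=
  [tuple inord (index (s i + 2 - i) [:: 0; 1; 4]) | i < N].

Lemma size_values (w : seq 'I_3) : size (values w) = size w.
Proof. by elim: w => //= k w; rewrite size_map => ->. Qed.

Lemma nth_values (w : seq 'I_3) (i : nat) :
  i < size w -> nth 0 (values w) i = i + shift (nth ord0 w i).
Proof.
elim: w i => //= k w IHw [|i] // lt_iw /=.
by rewrite (nth_map 0) ?size_values // IHw.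
Qed.

Lemma shift_index (x : nat) :
  x \in [:: 0; 1; 4] -> shift (inord (index x [:: 0; 1; 4])) = x.
Proof.
move=> x_shift; rewrite /shift inordK ?nth_index //.
by rewrite -[3]/(size [:: 0; 1; 4]) index_mem.
Qed.

Lemma shift_inj : injective shift.
Proof.
move=> k l /eqP; rewrite /shift nth_uniq //= => /eqP; exact: val_inj.
Qed.

(** The guard [i <= a + 2] excludes truncated differences, which would pass as 0. *)
Lemma displacement_shift (a i : nat) :
  ((a%:Z - i%:Z)%R \in [:: (-2)%R; (-1)%R; 2%R]) =
  (i <= a + 2) && (a + 2 - i \in [:: 0; 1; 4]).
Proof. rewrite !inE; lia. Qed.

(** [displacement_code] is injective on [X], and its image is the set of words whose values
    rearrange [iota 2 N]. *)
Lemma card_displaced_perms (N : nat) :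
  #|[set s : 'S_N |
      [forall i, ((s i)%:Z - i%:Z)%R \in [:: (-2)%R; (-1)%R; 2%R]]]| =
  arrangements N (iota 2 N).
Proof.
set X := [set s | _].
have shiftX s : s \in X -> forall i : 'I_N,
    i + shift (tnth (displacement_code N s) i) = s i + 2.
  rewrite inE => /forallP sX i; have := sX i.
  by rewrite displacement_shift tnth_mktuple => /andP[le_i /shift_index ->]; rewrite subnKC.
have codeK : {in X &, injective (displacement_code N)}.
  move=> s t sX tX st; apply/permP => i; apply/val_inj/eqP => /=.
  by rewrite -(eqn_add2r 2) -!shiftX // st.
have valuesE (w : N.-tuple 'I_3) (i : 'I_N) :
    nth 0 (values w) i = i + shift (tnth w i).
  by rewrite nth_values ?size_tuple // (tnth_nth ord0).
rewrite /arrangements -(card_in_imset codeK); apply: eq_card => w.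
rewrite inE; apply/imsetP/idP => [[s sX ->] | w_perm].
  have -> : values (displacement_code N s) = [seq val (s i) + 2 | i <- enum 'I_N].
    apply: (@eq_from_nth _ 0) => [|i]; rewrite size_values size_tuple.
      by rewrite size_map size_enum_ord.
    move=> lt_iN; rewrite (nth_map (Ordinal lt_iN)) ?size_enum_ord //.
    by rewrite -[i]/(val (Ordinal lt_iN)) valuesE shiftX // nth_ord_enum.
  have -> : iota 2 N = [seq val i + 2 | i <- enum 'I_N].
    by rewrite (iotaDl 2 0) -val_enum_ord -map_comp; apply: eq_map => i /=; rewrite addnC.
  rewrite (map_comp (fun i : 'I_N => val i + 2) s); apply: perm_map.
  apply: uniq_perm => [||i]; rewrite ?(map_inj_uniq perm_inj) ?enum_uniq //.
  by rewrite mem_enum; apply/mapP; exists ((s^-1)%g i); rewrite ?mem_enum ?permKV.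
have bounds (i : 'I_N) : 2 <= i + shift (tnth w i) < 2 + N.
  by rewrite -valuesE -mem_iota -(perm_mem w_perm) mem_nth // size_values size_tuple.
have ltN (i : 'I_N) : i + shift (tnth w i) - 2 < N by have := bounds i; lia.
(* The permutation coded by [w]; it is injective because [values w] has no repetition. *)
pose f (i : 'I_N) := Ordinal (ltN i).
have f_inj : injective f.
  move=> i j /(congr1 val) /= eq_ij; apply/val_inj/eqP => /=.
  rewrite -(@nth_uniq _ 0 (values w)) ?size_values ?size_tuple //; last first.
    by rewrite (perm_uniq w_perm) iota_uniq.
  have [/andP[bi _] /andP[bj _]] := (bounds i, bounds j).
  by rewrite !valuesE -(subnK bi) eq_ij subnK.
have f_shift i : val (perm f_inj i) + 2 = i + shift (tnth w i).
  by rewrite permE /= subnK //; case/andP: (bounds i).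
have pX : perm f_inj \in X.
  rewrite inE; apply/forallP => i; rewrite displacement_shift f_shift leq_addr addKn.
  by rewrite mem_nth.
exists (perm f_inj) => //; apply: eq_from_tnth => i; apply: shift_inj.
by apply/eqP; rewrite -(eqn_add2l i) shiftX // f_shift.
Qed.

Theorem theorem2p3 (n : nat) (n_gt0 : 0 < n) :
  #|[set C : configuration n | maximal_configuration C]| =
  #|[set s : 'S_(n + 4) |
      [forall i, ((s i)%:Z - i%:Z)%R \in [:: (-2)%R; (-1)%R; 2%R]]]|.
Proof.
have start1 : #|[set s : n.-tuple bool | continuation S1100 (true :: s)]| = 0.
  by apply/eqP; rewrite cards_eq0; apply/eqP/setP => s; rewrite !inE continuation_cons.
(* [iota 2 n.+4] unfolds to [free S1100 ++ iota 4 n.+2]; the forced first letter [false] then leads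
   to [S1001], that is, [scan false false]. *)
rewrite card_displaced_perms addn4 (arrangements_free S1100 n.+1).
rewrite card_tupleS big_bool start1.
by apply: eq_card => C; rewrite !inE continuation_cons maximal_configurationE.
Qed.
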